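(* Let $q\ge 5$. Then in the closure order $\preceq$ on $\mathbf W(q-2,2)$ the following relations hold: (1) $\gamma_{j+1,\,q+1-j}\preceq\gamma_{j,\,q+3-j}$ for every integer $j$ with $3\le j<q/2$; (2) $\gamma_{q-j,\,j+1}\preceq\gamma_{q-j+2,\,j}$ for every integer $j$ with $q/2+1<j\le q-1$.
   Context: Permutations in $\mathfrak S_q$ are composed right to left; $(i,\dots,u)$ is the cycle $i\mapsto i+1\mapsto\cdots\mapsto u\mapsto i$. $\mathfrak S_q$ is a Coxeter group with simple reflections $s_i=(i,i+1)$, length $\ell$ = number of inversions, and Bruhat order $\le$ (the standard Bruhat order: $w'\le w$ iff there is a chain $w'=v_0,\dots,v_m=w$ with $\ell(v_{i-1})\le\ell(v_i)$ and each $v_{i-1}^{-1}v_i$ a reflection). For $1\le u<v\le q$ let $\gamma_{u,v}=(2,3,\ldots,v)(1,2,\ldots,u)$; the set $\mathbf W(q-2,2)=\{\gamma_{u,v}:1\le u<v\le q\}$ is the set of minimal-length representatives of $W_J\backslash\mathfrak S_q$, where $J=\{s_1,\dots,s_{q-1}\}\setminus\{s_2\}$ and $W_J=\langle J\rangle$. Let $w_{0,J}$ be the longest element of $W_J$, i.e. the permutation swapping $1$ and $2$ and sending $x\mapsto q+3-x$ for $3\le x\le q$. The closure order on $\mathbf W(q-2,2)$ is defined by: $w\preceq w'$ iff there exists $h\in W_J$ with $$h\,w\,w_{0,J}\,h^{-1}\,w_{0,J}\le w'$$ in the Bruhat order of $\mathfrak S_q$. (This order describes topological closure relations between Ekedahl–Oort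 strata of the unitary Shimura variety of signature $(q-2,2)$.) *)

(* Defs.v *)
From HB Require Import structures.
From mathcomp Require Import all_boot all_fingroup zify.

Set Implicit Arguments.
Unset Strict Implicit.
Unset Printing Implicit Defensive.

Local Open Scope group_scope.

(* The letters 1, ..., q are the ordinals 0, ..., q-1: x : 'I_q is the letter
   x.+1. All indices i, u, v, j below are 1-based letters. *)

(* MathComp's s * t applies s first; s <o> t applies t first. *)
Definition pcomp (q : nat) (s t : 'S_q) : 'S_q := t * s.

Notation "s <o> t" := (pcomp s t) (at level 40, left associativity).

Lemma pcompE (q : nat) (s t : 'S_q) (x : 'I_q) : (s <o> t) x = s (t x).
Proof. exact: permM. Qed.

Definition cyc_seq (q i u : nat) : seq 'I_q :=
  [seq x : 'I_q <- enum 'I_q | i <= x.+1 <= u].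

Lemma cyc_seq_uniq (q i u : nat) : uniq (cyc_seq q i u).
Proof. exact/filter_uniq/enum_uniq. Qed.

(* The cycle (i, i+1, ..., u): [next c] is the identity outside of c and maps
   the last item of c to the first; enum 'I_q is increasing. *)
Definition cyc (q i u : nat) : 'S_q :=
  perm (can_inj (prev_next (cyc_seq_uniq q i u))).

Lemma val_cyc_seq (q i u : nat) : 0 < i -> i <= u -> u <= q ->
  map val (cyc_seq q i u) = iota i.-1 (u.+1 - i).
Proof.
move=> i0 iu uq; rewrite /cyc_seq.
rewrite -(filter_map val (fun k => i <= k.+1 <= u)) val_enum_ord.
have -> : q = i.-1 + ((u.+1 - i) + (q - u)) by lia.
rewrite !iotaD !filter_cat add0n.
rewrite (eq_in_filter (a2 := pred0)); last first.
  by move=> k; rewrite mem_iota /=; lia.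
rewrite filter_pred0 /= (eq_in_filter (a2 := predT)); last first.
  by move=> k; rewrite mem_iota /=; lia.
rewrite filter_predT (eq_in_filter (a2 := pred0)) ?filter_pred0 ?cats0 //.
by move=> k; rewrite mem_iota /=; lia.
Qed.

Lemma cycE (q i u : nat) (x : 'I_q) : 0 < i -> i <= u -> u <= q ->
  (cyc q i u x).+1 =
    if i <= x.+1 < u then x.+2 else if x.+1 == u then i else x.+1.
Proof.
move=> i0 iu uq; rewrite permE -(next_map val_inj (cyc_seq_uniq q i u)).
rewrite val_cyc_seq // next_nth mem_iota.
have iotaS : iota i.-1 (u.+1 - i) = i.-1 :: iota i (u - i).
  by rewrite subSn //= prednK.
rewrite {1}iotaS /=; move: (nat_of_ord x) => k.
case: ifP => kin; last by do ![case: ifP => ?]; lia.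
have {1}-> : k = nth 0 (iota i.-1 (u.+1 - i)) (k - i.-1).
  by rewrite nth_iota; lia.
rewrite index_uniq ?iota_uniq ?size_iota; last by lia.
case: (ltnP k.+1 u) => ku.
  by rewrite nth_iota; [do ![case: ifP => ?]; lia|lia].
by rewrite nth_default ?size_iota; [do ![case: ifP => ?]; lia|lia].
by lia.
Qed.

Definition simple_refl (q i : nat) : 'S_q := cyc q i i.+1.

Definition simple_refls (q : nat) : {set 'S_q} :=
  [set simple_refl q (val i) | i : 'I_q & 0 < val i].

Definition reflections (q : nat) : {set 'S_q} :=
  class_support (simple_refls q) [set: 'S_q].

Definition length (q : nat) (w : 'S_q) : nat :=
  #|[set p : 'I_q * 'I_q | (p.1 < p.2) && (w p.2 < w p.1)]|.

Definition bruhat_step (q : nat) : rel 'S_q :=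
  fun v v' => (length v <= length v') && (v^-1 <o> v' \in reflections q).

Definition bruhat_le (q : nat) : rel 'S_q := connect (@bruhat_step q).

Definition gamma (q u v : nat) : 'S_q := cyc q 2 v <o> cyc q 1 u.

Definition in_W (q : nat) (w : 'S_q) : Prop :=
  exists u v : nat, [/\ 1 <= u, u < v, v <= q & w = gamma q u v].

Definition W_J (q : nat) : {group 'S_q} :=
  <<simple_refls q :\ simple_refl q 2>>%G.

Definition w0J_letter (q k : nat) : nat :=
  if k <= 2 then 3 - k else q + 3 - k.

(* Reversing {1, 2} and {3, ..., q} separately gives the longest element of
   W_J, which is the product of the symmetric groups on these two blocks.
   For q >= 2 the value is always in range; the default x of insubd is only
   reached when q = 1. *)
Definition w0J_fun (q : nat) (x : 'I_q) : 'I_q :=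
  insubd x (w0J_letter q x.+1).-1.

Lemma w0J_fun_inj (q : nat) : injective (@w0J_fun q).
Proof.
move=> x y /(congr1 val); rewrite !val_insubd /w0J_letter => e.
apply: val_inj; move: (ltn_ord x) (ltn_ord y) e => /=.
by do ![case: ifP]; lia.
Qed.

Definition w0J (q : nat) : 'S_q := perm (@w0J_fun_inj q).

Definition closure_le (q : nat) (w w' : 'S_q) : Prop :=
  [/\ in_W w, in_W w' &
      exists2 h : 'S_q, h \in W_J q &
        bruhat_le (h <o> w <o> w0J q <o> h^-1 <o> w0J q) w'].

(* Main.v *)
Require Import Defs.
From mathcomp Require Import all_boot all_fingroup.
From mathcomp Require Import zify.

Set Implicit Arguments.
Unset Strict Implicit.
Unset Printing Implicit Defensive.

(* Write v for the twisted conjugate of the smaller element by h = s_m, with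
   m = q + 2 - j in (1) and m = q - j + 2 in (2). Since w_{0,J} s_m w_{0,J} is
   s_{q+2-m}, that is s_j in both cases, v = s_m w s_j; and this is w' composed
   with a single transposition of two letters a < b = a + 2 with
   w'(b) < w'(a), so v < w' is one step of the Bruhat order. The letter b is the
   position of 2 in w' = gamma_{j, q+3-j} for (1), and of 1 in
   w' = gamma_{q-j+2, j} for (2). *)

(** The map [f] injects the inversions of [w <o> t] into those of [w]: it applies [t] to both
    letters if this keeps their order, and otherwise leaves the pair alone. *)
Lemma length_tperm_le (q : nat) (w : 'S_q) (a b : 'I_q) :
  a < b -> w b < w a -> length (w <o> tperm a b) <= length w.
Proof.
move=> ab wba; set t := tperm a b.
pose f (p : 'I_q * 'I_q) := if t p.1 < t p.2 then (t p.1, t p.2) else p.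
rewrite /length -(card_in_imset (f := f)); last first.
  move=> [x y] [x' y']; rewrite !inE /= => /andP[xy _] /andP[xy' _].
  rewrite /f /=; case: ifP => txy; case: ifP => txy' [] ex ey.
  - by rewrite (perm_inj ex) (perm_inj ey).
  - by move: txy'; rewrite -ex -ey !tpermK xy.
  - by move: txy; rewrite ex ey !tpermK xy'.
  - by rewrite ex ey.
apply/subset_leq_card/subsetP => _ /imsetP[[x y] + ->].
rewrite !inE /= !pcompE /f /= => /andP[xy].
case: ifP => [txy wyx /=|/negbT]; first by rewrite txy.
(* Now [t] reverses x < y, so x = a and y <= b, or y = b and a <= x; comparing through w b < w a
   shows that (x, y) is an inversion of [w]. *)
rewrite xy /=; move: xy.
by rewrite /t; case: tpermP => [->|->|_ _]; case: tpermP => [->|->|_ _]; lia.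
Qed.

Lemma simple_reflE (q i : nat) (x : 'I_q) : 0 < i -> i < q ->
  (simple_refl q i x).+1 =
    if x.+1 == i then i.+1 else if x.+1 == i.+1 then i else x.+1.
Proof.
by move=> i0 iq; rewrite cycE //; do ![case: ifP => ?]; lia.
Qed.

(** As a number, [b] is the 1-based letter of [a]. *)
Lemma simple_refl_tperm (q : nat) (a b : 'I_q) :
  b = a.+1 :> nat -> simple_refl q b = tperm a b.
Proof.
move=> ba; have bq := ltn_ord b.
apply/permP => x; apply/val_inj/succn_inj; rewrite simple_reflE ?ba //; try lia.
case: tpermP => [->|->|/eqP xa /eqP xb] /=; try by do ![case: ifP]; lia.
by move: xa xb; rewrite -!val_eqE /=; do ![case: ifP]; lia.
Qed.

Lemma simple_reflV (q i : nat) : 0 < i -> i < q ->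
  (simple_refl q i)^-1%g = simple_refl q i.
Proof.
move=> i0 iq; have iq' : i.-1 < q by lia.
rewrite (@simple_refl_tperm q (Ordinal iq') (Ordinal iq)) ?tpermV //=; lia.
Qed.

Lemma tperm_reflection (q : nat) (a b : 'I_q) :
  a != b -> tperm a b \in reflections q.
Proof.
rewrite -val_eqE /= => ab.
have q1 : 1 < q by move: (ltn_ord a) (ltn_ord b); lia.
pose o0 : 'I_q := Ordinal (ltnW q1); pose o1 : 'I_q := Ordinal q1.
(* The conjugator of s_1 first moves [o0] to [a] and [o1] to [c]; as [c] differs from [a], swapping
   [c] with [b] then keeps [a] in place. *)
pose c := tperm o0 a o1.
have ca : c != a by rewrite /c -[X in _ != X](tpermL o0 a) (inj_eq perm_inj).
have -> : tperm a b = (simple_refl q 1 ^ (tperm o0 a * tperm c b))%g.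
  rewrite (@simple_refl_tperm q o0 o1) // tpermJ !permM !tpermL.
  by rewrite (tpermD ca) // eq_sym.
rewrite memJ_class_support ?inE //; apply/imsetP; exists o1 => //.
by rewrite inE.
Qed.

Lemma simple_refl_in_W_J (q i : nat) : 2 < i -> i < q ->
  simple_refl q i \in W_J q.
Proof.
move=> i2 iq; apply: mem_gen; rewrite !inE; apply/andP; split; last first.
  by apply/imsetP; exists (Ordinal iq) => //; rewrite inE /=; lia.
(* The letter i + 1 is moved by s_i but fixed by s_2, as i > 2. *)
apply/eqP => /permP/(_ (Ordinal iq))/(congr1 (fun y : 'I_q => y.+1)).
by rewrite !simple_reflE //=; do ?[case: ifP => ?]; lia.
Qed.

Lemma w0JE (q : nat) (x : 'I_q) : 1 < q -> (w0J q x).+1 = w0J_letter q x.+1.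
Proof.
move=> q1; rewrite permE val_insubd /w0J_letter.
by move: (ltn_ord x); do ![case: ifP]; lia.
Qed.

Lemma w0J_conj_simple_refl (q m : nat) : 2 < m -> m < q ->
  w0J q <o> simple_refl q m <o> w0J q = simple_refl q (q + 2 - m).
Proof.
move=> m2 mq; apply/permP => x; apply/val_inj/succn_inj.
rewrite !pcompE w0JE ?simple_reflE ?w0JE /w0J_letter; try lia.
by move: (ltn_ord x); do ![case: ifP]; lia.
Qed.

(** One-line notation: 3, ..., u+1, 1, u+2, ..., v, 2, v+1, ..., q. *)
Lemma gammaE (q u v : nat) (x : 'I_q) : 0 < u -> u < v -> v <= q ->
  (gamma q u v x).+1 =
    if x.+1 < u then x.+3 else if x.+1 == u then 1 else
    if x.+1 < v then x.+2 else if x.+1 == v then 2 else x.+1.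
Proof.
move=> u0 uv vq; rewrite pcompE cycE ?cycE //; try lia.
by do ![case: ifP]; lia.
Qed.

(** Reduces both relations to an identity of permutations, with s_m as the witness in W_J. *)
Lemma closure_le_simple (q u v u' v' m : nat) (a b : 'I_q) :
  0 < u -> u < v -> v <= q -> 0 < u' -> u' < v' -> v' <= q ->
  2 < m -> m < q -> a < b -> gamma q u' v' b < gamma q u' v' a ->
  simple_refl q m <o> gamma q u v <o> simple_refl q (q + 2 - m) =
    gamma q u' v' <o> tperm a b ->
  closure_le (gamma q u v) (gamma q u' v').
Proof.
move=> u0 uv vq u'0 uv' vq' m2 mq ab gab e.
split; [by exists u, v | by exists u', v' |].
exists (simple_refl q m); first exact: simple_refl_in_W_J.
rewrite simple_reflV //; last by lia.
have {e} -> : simple_refl q m <o> gamma q u v <o> w0J q <o> simple_refl q m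
    <o> w0J q = gamma q u' v' <o> tperm a b.
  by rewrite -e -w0J_conj_simple_refl // /Defs.pcomp !mulgA.
apply: connect1; rewrite /bruhat_step length_tperm_le //=.
have -> : (gamma q u' v' <o> tperm a b)^-1%g <o> gamma q u' v' = tperm a b.
  by rewrite /Defs.pcomp invMg tpermV mulKVg.
by apply: tperm_reflection; rewrite -val_eqE /=; lia.
Qed.

Theorem theorem3p11 (q : nat) (hq : 5 <= q) :
  (forall j : nat, 3 <= j -> 2 * j < q ->
     closure_le (gamma q (j + 1) (q + 1 - j)) (gamma q j (q + 3 - j)))
  /\
  (forall j : nat, q + 2 < 2 * j -> j <= q - 1 ->
     closure_le (gamma q (q - j) (j + 1)) (gamma q (q - j + 2) j)).
Proof.
split=> j j1 j2.
(* These are the letters q+1-j and q+3-j, sent by the larger element to q+2-j and 2. *)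
- have aq : q - j < q by lia.
  have bq : q + 2 - j < q by lia.
  apply: (@closure_le_simple _ _ _ _ _ (q + 2 - j) (Ordinal aq) (Ordinal bq));
    rewrite /=; try lia.
    by rewrite -ltnS !gammaE /=; do ?[case: ifP]; lia.
  apply/permP => x; apply/val_inj/succn_inj; rewrite 2!pcompE [in RHS]pcompE.
  have -> : q + 2 - (q + 2 - j) = j by lia.
  rewrite simple_reflE ?[RHS]gammaE; try lia.
  have ey := @simple_reflE q j x ltac:(lia) ltac:(lia).
  set y := simple_refl q j x in ey *.
  have := @gammaE q (j + 1) (q + 1 - j) y ltac:(lia) ltac:(lia) ltac:(lia).
  (* Only numbers bound by the piecewise formulas remain, so each case is linear arithmetic. *)
  move: (gamma _ _ _ y) => z; move: ey; move: {z}z.+1 {y}y.+1 => z y.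
  case: tpermP => [->|->|/eqP + /eqP +]; rewrite -?val_eqE /=;
    by do ![case: ifP => ?; try lia].
(* These are the letters q-j and q-j+2, sent by the larger element to q-j+2 and 1. *)
- have aq : q - j - 1 < q by lia.
  have bq : q - j + 1 < q by lia.
  apply: (@closure_le_simple _ _ _ _ _ (q - j + 2) (Ordinal aq) (Ordinal bq));
    rewrite /=; try lia.
    by rewrite -ltnS !gammaE /=; do ?[case: ifP]; lia.
  apply/permP => x; apply/val_inj/succn_inj; rewrite 2!pcompE [in RHS]pcompE.
  have -> : q + 2 - (q - j + 2) = j by lia.
  rewrite simple_reflE ?[RHS]gammaE; try lia.
  have ey := @simple_reflE q j x ltac:(lia) ltac:(lia).
  set y := simple_refl q j x in ey *.
  have := @gammaE q (q - j) (j + 1) y ltac:(lia) ltac:(lia) ltac:(lia).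
  move: (gamma _ _ _ y) => z; move: ey; move: {z}z.+1 {y}y.+1 => z y.
  case: tpermP => [->|->|/eqP + /eqP +]; rewrite -?val_eqE /=;
    by do ![case: ifP => ?; try lia].
Qed.
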